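(* Let $2 \le n \in \mathbb{N}$ and $T \in \mathcal{B}(\mathbb{C}^n)$. The following are equivalent. (a) $T = MN - NM$ for some $M, N \in \mathcal{B}(\mathbb{C}^n)$ with $M^2 = 0 = N^2$. (b) There exist an integer $k$ with $0 \le 2k \le n$, an invertible operator $A \in \mathcal{B}(\mathbb{C}^k)$ and a nilpotent operator $L \in \mathcal{B}(\mathbb{C}^{n-2k})$ such that $T$ is similar to $(A \oplus -A) \oplus L^2$.
   Context: Two operators $X, Y$ are similar if $Y = S^{-1} X S$ for some invertible $S$. When $k = 0$ the summand $A \oplus -A$ is absent, and when $2k = n$ the summand $L^2$ is absent. *)

(* Defs.v *)
From HB Require Import structures.
From mathcomp Require Import all_boot all_order all_algebra.
From mathcomp Require Import complex.
From mathcomp Require Import reals.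
Set Implicit Arguments. Unset Strict Implicit. Unset Printing Implicit Defensive.
Import Order.TTheory GRing.Theory Num.Theory.
Local Open Scope ring_scope.

(* The complex numbers are modelled as R[i] for R : realType (the real numbers). *)

Definition similar_mx (F : fieldType) (n : nat) (X Y : 'M[F]_n) : Prop :=
  exists2 S : 'M[F]_n, S \in unitmx & Y = invmx S *m X *m S.

Definition nilpotent_mx (F : fieldType) (n : nat) (L : 'M[F]_n) : Prop :=
  exists p : nat, L ^+ p = 0.

Definition dsum_AmA_L2 (F : fieldType) (k m : nat) (A : 'M[F]_k) (L : 'M[F]_m)
  : 'M[F]_(k + k + m) :=
  block_mx (block_mx A 0 0 (- A)) 0 0 (L ^+ 2).

(* Main.v *)
Require Import Defs.
From HB Require Import structures.
From mathcomp Require Import all_boot all_order all_algebra.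
From mathcomp Require Import complex.
From mathcomp Require Import reals.
From mathcomp Require Import zify.
Set Implicit Arguments. Unset Strict Implicit. Unset Printing Implicit Defensive.
Import Order.TTheory GRing.Theory Num.Theory.
Local Open Scope ring_scope.

(** Write r_j for the rank of T^j and d_j = r_j - r_(j+1), so that, for T
    nilpotent, d_j is the number of Jordan blocks of size larger than j.  Let
    M^2 = N^2 = 0 and T = MN - NM.  Then M and N anticommute with T, hence
    preserve its Fitting decomposition.  Where T is invertible, the images of M
    and N are complementary, and T acts on them as A and as a conjugate of -A.
    For every j with d_j = d_(j+1), the space C = im T^j /\ ker T (of dimension
    d_j) lies in im T^(j+1), and expanding M, N to first order along T over C
    gives M1 N0 + N0 M1 - (M0 N1 + N1 M0) = 1 with M0, N0 commuting and of
    square zero; on the homology of M0 this makes M1 a contracting homotopy of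
    N0, so d_j is even.  This parity condition also holds for squares of
    nilpotents, and for nilpotent T it forces the Jordan blocks to be paired with
    sizes s' <= s <= s' + 1.  If X and Y are the two maps between F^s and F^s'
    with XY = J_s and YX = J_s', then J_s (+) J_s' is the square of the
    off-diagonal matrix with blocks X, Y, and up to the sign of J_s' it is the
    commutator of its two halves. *)

(** * Similarity and block-diagonal sums *)

Section Similarity.
Variable F : fieldType.

(** Rectangular [S] and [S'] let matrices of syntactically different sizes be compared without
    casts; equality of the sizes becomes a consequence. *)
Definition hsimilar n m (X : 'M[F]_n) (Y : 'M[F]_m) :=
  exists (S : 'M_(m, n)) (S' : 'M_(n, m)),
    [/\ S *m S' = 1%:M, S' *m S = 1%:M & Y = S *m X *m S'].

Lemma hsimilar_refl n (X : 'M[F]_n) : hsimilar X X.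
Proof. by exists 1%:M, 1%:M; rewrite !mulmx1 mul1mx. Qed.

Lemma hsimilar_sym n m (X : 'M[F]_n) (Y : 'M[F]_m) :
  hsimilar X Y -> hsimilar Y X.
Proof.
move=> [S [S' [SS' S'S ->]]]; exists S', S; split=> //.
by rewrite !mulmxA S'S mul1mx -mulmxA S'S mulmx1.
Qed.

Lemma hsimilar_trans n m p (X : 'M[F]_n) (Y : 'M[F]_m) (Z : 'M[F]_p) :
  hsimilar X Y -> hsimilar Y Z -> hsimilar X Z.
Proof.
move=> [S [S' [SS' S'S ->]]] [P [P' [PP' P'P ->]]].
exists (P *m S), (S' *m P'); split; last by rewrite !mulmxA.
- by rewrite mulmxA -(mulmxA P) SS' mulmx1.
- by rewrite mulmxA -(mulmxA S') P'P mulmx1.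
Qed.

Lemma hsimilar_dim n m (X : 'M[F]_n) (Y : 'M[F]_m) : hsimilar X Y -> n = m.
Proof.
move=> [S [S' [SS' S'S _]]]; apply/eqP; rewrite eqn_leq.
rewrite -[X in (X <= _)%N](mxrank1 F) -S'S (leq_trans (mxrankM_maxr _ _)) ?rank_leq_row //.
by rewrite -[X in (X <= _)%N](mxrank1 F) -SS' (leq_trans (mxrankM_maxr _ _)) ?rank_leq_row.
Qed.

Lemma hsimilar_exp n m (X : 'M[F]_n) (Y : 'M[F]_m) p :
  hsimilar X Y -> hsimilar (X ^+ p) (Y ^+ p).
Proof.
move=> [S [S' [SS' S'S ->]]]; exists S, S'; split=> //.
elim: p => [|p IHp]; first by rewrite !expr0 mulmx1 SS'.
rewrite !exprS IHp -!mulmxE -!mulmxA; congr (_ *m (_ *m _)).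
by rewrite !mulmxA S'S mul1mx.
Qed.

Lemma hsimilar_rank n m (X : 'M[F]_n) (Y : 'M[F]_m) :
  hsimilar X Y -> \rank X = \rank Y.
Proof.
have le k l (A : 'M[F]_k) (B : 'M[F]_l) : hsimilar A B -> (\rank B <= \rank A)%N.
  move=> [S [S' [_ _ ->]]].
  exact: leq_trans (mxrankM_maxl _ _) (mxrankM_maxr _ _).
by move=> XY; apply/eqP; rewrite eqn_leq !le //; apply: hsimilar_sym.
Qed.

Lemma hsimilar_dsum n m p q (X : 'M[F]_n) (X' : 'M[F]_m) (Y : 'M[F]_p)
    (Y' : 'M[F]_q) :
  hsimilar X X' -> hsimilar Y Y' ->
  hsimilar (block_mx X 0 0 Y) (block_mx X' 0 0 Y').
Proof.
move=> [S [S' [SS' S'S ->]]] [P [P' [PP' P'P ->]]].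
exists (block_mx S 0 0 P), (block_mx S' 0 0 P').
by rewrite !mulmx_block !mul0mx !mulmx0 !add0r !addr0 SS' S'S PP' P'P
  -!scalar_mx_block !mul0mx.
Qed.

Lemma hsimilar_cast n m (e : n = m) (X : 'M[F]_n) :
  hsimilar X (castmx (e, e) X).
Proof. by case: m / e; rewrite castmx_id; apply: hsimilar_refl. Qed.

Lemma hsimilar_dsumA n m p (X : 'M[F]_n) (Y : 'M[F]_m) (Z : 'M[F]_p) :
  hsimilar (block_mx X 0 0 (block_mx Y 0 0 Z))
           (block_mx (block_mx X 0 0 Y) 0 0 Z).
Proof.
have := @block_mxA F n m p n m p X 0 0 0 Y 0 0 0 Z.
rewrite /= !row_mx0 !col_mx0 => ->.
exact/hsimilar_sym/hsimilar_cast.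
Qed.

Lemma dsum_exp n m (X : 'M[F]_n) (Y : 'M[F]_m) p :
  block_mx X 0 0 Y ^+ p = block_mx (X ^+ p) 0 0 (Y ^+ p).
Proof.
elim: p => [|p IHp]; first by rewrite !expr0 -scalar_mx_block.
by rewrite !exprS IHp -!mulmxE mulmx_block !mul0mx !mulmx0 !add0r !addr0.
Qed.

Lemma mulmx_exp_intertwine n m (B : 'M[F]_(m, n)) (T : 'M_n) (J : 'M_m) p :
  B *m T = J *m B -> B *m T ^+ p = J ^+ p *m B.
Proof.
move=> BT; elim: p => [|p IHp]; first by rewrite !expr0 mulmx1 mul1mx.
by rewrite exprS (exprS J) -!mulmxE mulmxA BT -mulmxA IHp mulmxA.
Qed.

(* The row space of [B] and the annihilator of the columns of [P] are
   [T]-stable, and they are complementary since [B *m P] is invertible. *)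
Lemma hsimilar_split n s (T : 'M[F]_n) (B : 'M_(s, n)) (P : 'M_(n, s))
    (J J' : 'M_s) :
  B *m T = J *m B -> T *m P = P *m J' -> B *m P \in unitmx ->
  exists (m : nat) (T' : 'M_m), hsimilar T (block_mx J 0 0 T').
Proof.
move=> BT TP uBP; pose K := row_base (kermx P).
pose Q := P *m invmx (B *m P).
have KP : K *m P = 0 by apply/eqP; rewrite -sub_kermx eq_row_base.
have BQ : B *m Q = 1%:M by rewrite mulmxA mulmxV.
have KQ : K *m Q = 0 by rewrite mulmxA KP mul0mx.
have [V KV subK] : exists2 V, K *m V = 1%:M
    & forall m (x : 'M_(m, n)), x *m P = 0 -> x *m V *m K = x.
  exists (pinvmx K) => [|m x xP]; first by rewrite mulmxVp ?row_base_free.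
  by rewrite mulmxKpV // eq_row_base sub_kermx xP.
(* [E] is the projection onto the annihilator of [P] along the row space of [B]. *)
pose E : 'M_n := 1%:M - Q *m B.
have EP : E *m P = 0.
  by rewrite mulmxBl mul1mx -!mulmxA mulVmx // mulmx1 subrr.
have BE : B *m E = 0 by rewrite mulmxBr mulmx1 mulmxA BQ mul1mx subrr.
have KE : K *m E = K by rewrite mulmxBr mulmx1 mulmxA KQ mul0mx subr0.
clearbody K.
exists (\rank (kermx P)), (K *m T *m V).
have KT : K *m T = K *m T *m V *m K.
  by rewrite subK // -mulmxA TP mulmxA KP mul0mx.
exists (col_mx B K), (row_mx Q (E *m V)); split.
- by rewrite mul_col_row BQ KQ !mulmxA BE mul0mx KE KV -scalar_mx_block.
- by rewrite mul_row_col subK // addrC subrK.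
- rewrite mul_col_mx mul_col_row BT.
  rewrite KT -!(mulmxA _ _ Q) BQ KQ mulmx1 mulmx0.
  by rewrite !mulmxA -!(mulmxA _ _ E) BE KE mulmx0 mul0mx -KT.
Qed.

(** * Shift matrices, the nilpotent Jordan blocks *)

Definition shift_mx a b j : 'M[F]_(a, b) := \matrix_(i, k) ((i + j)%N == k)%:R.

Lemma sum_delta (b x : nat) (f : 'I_b -> F) :
  \sum_(k < b) (x == k)%:R * f k = oapp f 0 (insub x).
Proof.
case: insubP => [k _ <-|xb] /=.
  rewrite (bigD1 k) //= eqxx mul1r big1 ?addr0 // => l /negPf lk.
  by rewrite eq_sym [_ == _]lk mul0r.
apply: big1 => k _; case: eqP => [xk|_]; last by rewrite mul0r.
by rewrite xk ltn_ord in xb.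
Qed.

(** Index [i] moves to [i + j], then to [i + j + k]. If the midpoint leaves the range [b], the
    endpoint is at least [b + k >= c], so both sides vanish there. *)
Lemma mul_shift_mx a b c j k : (c <= b + k)%N ->
  shift_mx a b j *m shift_mx b c k = shift_mx a c (j + k).
Proof.
move=> cb; apply/matrixP=> i l; rewrite !mxE.
under eq_bigr => x _ do rewrite !mxE.
rewrite sum_delta; case: insubP => [y _ /= ->|ib] /=; first by rewrite addnA.
by case: eqP => // eil; have := ltn_ord l; rewrite -eil; lia.
Qed.

Lemma shift_mx_exp s j : shift_mx s s 1 ^+ j = shift_mx s s j.
Proof.
elim: j => [|j IHj].
  by apply/matrixP=> i k; rewrite expr0 !mxE addn0.
by rewrite exprS IHj -mulmxE mul_shift_mx ?leq_addr.
Qed.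

Lemma rank_shift_mx s j : \rank (shift_mx s s j) = (s - j)%N.
Proof.
have rp : \rank (pid_mx (s - j) : 'M[F]_s) = (s - j)%N.
  by rewrite rank_pid_mx ?leq_subr.
apply/eqP; rewrite eqn_leq; apply/andP; split.
  have -> : shift_mx s s j = pid_mx (s - j) *m shift_mx s s j.
    apply/matrixP=> i k; rewrite !mxE.
    under eq_bigr => x _ do rewrite !mxE -mulnb natrM -mulrA.
    rewrite sum_delta; case: insubP => [y _ /= ->|]; last by rewrite ltn_ord.
    case: eqP => [e|_]; last by rewrite mulr0.
    by rewrite ltn_subRL addnC e ltn_ord mulr1.
  by apply: leq_trans (mxrankM_maxl _ _) _; rewrite rp.
rewrite -{1}rp.
have -> : pid_mx (s - j) = shift_mx s s j *m (shift_mx s s j)^T.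
  apply/matrixP=> i k; rewrite !mxE.
  under eq_bigr => x _ do rewrite !mxE.
  rewrite sum_delta; case: insubP => [y ib /= ->|ib] /=.
    by rewrite eqn_add2r eq_sym ltn_subRL addnC ib andbT.
  by rewrite ltn_subRL addnC (negPf ib) andbF.
exact: mxrankM_maxl.
Qed.

(** * Splitting off a largest Jordan block, and the Fitting decomposition *)

Lemma nilpotent_split n (T : 'M[F]_n) : nilpotent_mx T ->
  exists (s m : nat) (T' : 'M_m),
    T ^+ s = 0 /\ hsimilar T (block_mx (shift_mx s s 1) 0 0 T').
Proof.
move=> [p0 Tp0]; have exT : exists p, T ^+ p == 0 by exists p0; apply/eqP.
case: (ex_minnP exT) => -[|t] /eqP Ts min_s.
  (* A zero minimal exponent means [n = 0]; an empty block is split off. *)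
  have [|||m [T' TT']] := @hsimilar_split n 0 T 0 0 (shift_mx 0 0 1) 0.
  - by rewrite mul0mx mulmx0.
  - by rewrite mul0mx mulmx0.
  - by rewrite unitmxE det_mx00 unitr1.
  by exists 0%N, m, T'.
have /matrix0Pn[i [j Tij]] : T ^+ t != 0.
  by apply/negP=> /min_s; rewrite ltnn.
(* Row [a] of [B] is e_i T^a and column [b] of [P] is T^(t-b) e_j, where T^t has a nonzero (i,j)
   entry; [T] acts on both families as a shift. *)
pose B : 'M[F]_(t.+1, n) := \matrix_(a, c) (T ^+ a) i c.
pose P : 'M[F]_(n, t.+1) := \matrix_(c, b) (T ^+ (t - b)) c j.
have [|||m [T' TT']] :=
    @hsimilar_split n t.+1 T B P (shift_mx _ _ 1) (shift_mx _ _ 1).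
- apply/matrixP=> a c; rewrite !mxE.
  under eq_bigr => x _ do rewrite mxE.
  under [RHS]eq_bigr => x _ do rewrite mxE.
  rewrite sum_delta; have -> : \sum_(x < n) (T ^+ a) i x * T x c = (T ^+ a.+1) i c.
    by rewrite exprSr -mulmxE mxE.
  case: insubP => [y _ /= ye|at_] /=; first by rewrite mxE ye addn1.
  have -> : a.+1 = t.+1 by have := ltn_ord a; lia.
  by rewrite Ts mxE.
- apply/matrixP=> c b; rewrite !mxE.
  under eq_bigr => x _ do rewrite mxE.
  have -> : \sum_(x < n) T c x * (T ^+ (t - b)) x j = (T ^+ (t - b).+1) c j.
    by rewrite exprS -mulmxE mxE.
  case: (posnP b) => [b0|b_gt0].
    rewrite b0 subn0 Ts mxE big1 // => x _.
    by rewrite !mxE b0 addn1 mulr0.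
  have bt : (b.-1 < t.+1)%N by have := ltn_ord b; lia.
  rewrite (bigD1 (Ordinal bt)) //= big1 => [|x xb].
    rewrite !mxE /= addn1 prednK // eqxx mulr1 addr0.
    by congr ((T ^+ _) c j); have := ltn_ord b; lia.
  rewrite !mxE; case: eqP => [e|_]; last by rewrite mulr0.
  by case/eqP: xb; apply/val_inj; rewrite /= -e addn1.
(* The product is triangular: its entries (T^(t+a-b))_ij vanish for a > b because T^(t+1) = 0, and
   the diagonal entries are (T^t)_ij. *)
- have BP a b : (B *m P) a b = (T ^+ (a + (t - b))) i j.
    by rewrite exprD -mulmxE !mxE; apply: eq_bigr => x _; rewrite !mxE.
  rewrite unitmxE -det_tr det_trig.
    rewrite unitfE; apply/prodf_neq0 => a _.
    by rewrite mxE BP subnKC // -ltnS.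
  apply/is_trig_mxP => a b ab; rewrite mxE BP.
  have -> : (b + (t - a) = t.+1 + (b - a.+1))%N by have := ltn_ord a; lia.
  by rewrite exprD Ts mul0r mxE.
by exists t.+1, m, T'.
Qed.

(** Doubling the exponent either keeps the rank or lowers it strictly, and strict drops must end. *)
Lemma exists_rank_stable n (T : 'M[F]_n) :
  exists2 p, (0 < p)%N & \rank (T ^+ (p + p)) = \rank (T ^+ p).
Proof.
suff aux r p : (0 < p)%N -> (\rank (T ^+ p) < r)%N ->
    exists2 q, (0 < q)%N & \rank (T ^+ (q + q)) = \rank (T ^+ q).
  exact: (aux _ 1%N).
elim: r p => // r IHr p p_gt0 rp.
have le_r : (\rank (T ^+ (p + p)) <= \rank (T ^+ p))%N.
  by rewrite exprD -mulmxE mxrankM_maxl.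
have [eq_r|ne_r] := eqVneq (\rank (T ^+ (p + p))) (\rank (T ^+ p)).
  by exists p.
by apply: (IHr (p + p)%N); [rewrite addn_gt0 p_gt0 | lia].
Qed.

Lemma unitmx_expE n (X : 'M[F]_n) p :
  (0 < p)%N -> (X ^+ p \in unitmx) = (X \in unitmx).
Proof.
elim: p => // -[|p] IHp _ //.
by rewrite exprS -mulmxE unitmx_mul IHp // andbb.
Qed.

Lemma fitting_split n (T : 'M[F]_n) :
  exists (r m : nat) (T1 : 'M_r) (T0 : 'M_m),
    [/\ T1 \in unitmx, nilpotent_mx T0 & hsimilar T (block_mx T1 0 0 T0)].
Proof.
have [p p_gt0 rTp] := exists_rank_stable T.
have [r [P [B [PB freeB fullP rE]]]] : exists r (P : 'M_(n, r)) (B : 'M_(r, n)),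
    [/\ P *m B = T ^+ p, row_free B, row_full P & \rank (T ^+ p) = r].
  exists (\rank (T ^+ p)), (col_base _), (row_base _).
  by rewrite mulmx_base row_base_free col_base_full.
rewrite rE in rTp.
have TTp : T *m T ^+ p = T ^+ p *m T by rewrite mulmxE -exprS exprSr.
(* T^(2p) = P (BP) B still has rank [r], so the square matrix BP of size [r] has full rank. *)
have uBP : B *m P \in unitmx.
  rewrite -row_free_unit -row_leq_rank -{1}rTp exprD -mulmxE -PB.
  rewrite -mulmxA (mulmxA B) mulmxA.
  exact: leq_trans (mxrankM_maxl _ _) (mxrankM_maxr _ _).
pose J := B *m T *m pinvmx B.
have BT : B *m T = J *m B.
  rewrite mulmxKpV // -{1}(mul1mx B) -(mulVpmx fullP) -(mulmxA _ P) PB.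
  by rewrite -mulmxA -TTp -PB !mulmxA submxMl.
have TP : T *m P = P *m J.
  by rewrite -(mulmxKp freeB (T *m P)) -(mulmxA T P B) PB TTp -PB !mulmxA.
have [m [T' TT']] := hsimilar_split BT TP uBP.
(* Cancelling [B] in B T^p = J^p B gives J^p = BP. *)
have uJ : J \in unitmx.
  rewrite -(unitmx_expE _ p_gt0).
  by rewrite -(mulmxKp freeB (J ^+ p)) -(mulmx_exp_intertwine p BT) -PB mulmxA mulmxKp.
exists r, m, J, T'; split=> //; exists p.
(* J^p already accounts for the whole rank [r] of T^p, which leaves rank 0 for T'^p. *)
have /hsimilar_rank := hsimilar_exp p TT'.
rewrite dsum_exp rank_diag_block_mx rE (mxrank_unit (A := J ^+ p)) ?unitmx_expE //.
by move/eqP; rewrite -{1}[r]addn0 eqn_add2l eq_sym mxrank_eq0 => /eqP.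
Qed.

(** * The parity condition on rank drops *)

(** For nilpotent [T] the premise says that no Jordan block has size exactly [j.+1]. The
    subtractions are exact, as ranks of powers do not increase. *)
Definition even_steps n (T : 'M[F]_n) := forall j,
  (\rank (T ^+ j) - \rank (T ^+ j.+1) = \rank (T ^+ j.+1) - \rank (T ^+ j.+2))%N ->
  ~~ odd (\rank (T ^+ j) - \rank (T ^+ j.+1)).

Lemma rank_exp_shift_dsum s m (X : 'M[F]_m) j :
  \rank (block_mx (shift_mx s s 1) 0 0 X ^+ j) = (s - j + \rank (X ^+ j))%N.
Proof. by rewrite dsum_exp rank_diag_block_mx shift_mx_exp rank_shift_mx. Qed.

Lemma exp_eq0_le n (X : 'M[F]_n) s j : X ^+ s = 0 -> (s <= j)%N -> X ^+ j = 0.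
Proof. by move=> Xs sj; rewrite -(subnKC sj) exprD Xs mul0r. Qed.

(* The two largest Jordan blocks are split off at each step: their sizes differ
   by at most one, for otherwise the last two rank drops of [T] equal 1. *)
Lemma nilpotent_even_steps_ind (Q : forall n, 'M[F]_n -> Prop) :
  (forall n m (X : 'M_n) (Y : 'M_m), hsimilar X Y -> Q n X -> Q m Y) ->
  (forall n m (X : 'M_n) (Y : 'M_m), Q n X -> Q m Y ->
     Q (n + m)%N (block_mx X 0 0 Y)) ->
  (forall s s', (s' <= s <= s'.+1)%N ->
     Q (s + s')%N (block_mx (shift_mx s s 1) 0 0 (shift_mx s' s' 1))) ->
  forall n (T : 'M_n), nilpotent_mx T -> even_steps T -> Q n T.
Proof.
move=> Qsim Qsum Qpair n; have [k] := ubnP n; elim: k n => // k IHk n nk T nilT evT.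
have [s [m [T' [Ts TT']]]] := nilpotent_split nilT.
have rT j : \rank (T ^+ j) = (s - j + \rank (T' ^+ j))%N.
  by rewrite (hsimilar_rank (hsimilar_exp j TT')) rank_exp_shift_dsum.
have T's : T' ^+ s = 0.
  by apply/eqP; rewrite -mxrank_eq0; have := rT s; rewrite Ts mxrank0; lia.
have [s' [m' [T'' [T's' T'T'']]]] := nilpotent_split (ex_intro _ s T's).
have rT' j : \rank (T' ^+ j) = (s' - j + \rank (T'' ^+ j))%N.
  by rewrite (hsimilar_rank (hsimilar_exp j T'T'')) rank_exp_shift_dsum.
have rT''0 j : (s' <= j)%N -> \rank (T'' ^+ j) = 0%N.
  by move=> s'j; have := rT' j; rewrite (exp_eq0_le T's' s'j) mxrank0; lia.
have s's : (s' <= s)%N.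
  by have := rT' s; rewrite T's mxrank0; lia.
have ss' : (s <= s'.+1)%N.
  rewrite leqNgt; apply/negP=> s's2; have := evT s.-2.
  by rewrite !rT !rT' !rT''0; lia.
have dimT := hsimilar_dim TT'; have dimT' := hsimilar_dim T'T''.
(* In size 0 the induction cannot descend; the pair of empty blocks covers it. *)
have [n0|n_gt0] := posnP n.
  move: T {nilT evT Ts TT' rT}; rewrite n0 => T.
  have := Qpair 0%N 0%N isT; congr (Q _ _).
  by apply/matrixP=> -[].
have s_gt0 : (0 < s)%N.
  rewrite lt0n; apply/negP=> /eqP s0; move: Ts; rewrite s0 expr0 => /(congr1 mxrank).
  by rewrite mxrank1 mxrank0; lia.
have simT : hsimilar T (block_mx (block_mx (shift_mx s s 1) 0 0 (shift_mx s' s' 1)) 0 0 T'').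
  apply: hsimilar_trans TT' _; apply: hsimilar_trans _ (hsimilar_dsumA _ _ _).
  exact: hsimilar_dsum (hsimilar_refl _) T'T''.
apply: Qsim (hsimilar_sym simT) _; apply: Qsum; first by apply: Qpair; rewrite s's.
apply: IHk; first lia.
  exists s'; apply/eqP; rewrite -mxrank_eq0; exact/eqP/rT''0.
move=> j eqd; apply/negP=> oddd.
(* An odd drop is nonzero, so both removed blocks have size above [j.+1]. They add 2 to each of the
   two drops, so equality and parity pass to [T]. *)
have js' : (j.+1 < s')%N.
  rewrite ltnNge; apply/negP=> s'j; move: oddd.
  by rewrite eqd (rT''0 j.+1) // sub0n.
by have := evT j; rewrite !rT !rT'; lia.
Qed.

(** Rank-nullity for [L] on the row space of [L ^+ j]; matrices act on row vectors, so this row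
    space is the image. *)
Lemma rank_exp_step n (L : 'M[F]_n) j :
  (\rank (L ^+ j.+1) + \rank (L ^+ j :&: kermx L)%MS)%N = \rank (L ^+ j).
Proof. by rewrite -(mxrank_mul_ker (L ^+ j) L) mulmxE -exprSr. Qed.

Lemma submx_exp_step n (L : 'M[F]_n) j : (L ^+ j.+1 <= L ^+ j)%MS.
Proof. by rewrite exprS -mulmxE submxMl. Qed.

(** If e_i are the drops of [L], those of [L ^+ 2] are e_(2j) + e_(2j+1). The e_i do not increase,
    so two equal consecutive sums force four equal terms, and the sum is 2 e_(2j). *)
Lemma even_steps_sqr n (L : 'M[F]_n) : even_steps (L ^+ 2).
Proof.
move=> j; rewrite -!exprM.
have -> : (2 * j.+1 = (2 * j).+2)%N by lia.
have -> : (2 * j.+2 = (2 * j).+4)%N by lia.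
set i := (2 * j)%N.
have st k := rank_exp_step L k.
have dec k : (\rank (L ^+ k.+1 :&: kermx L)%MS <= \rank (L ^+ k :&: kermx L)%MS)%N.
  by rewrite mxrankS // capmxS // submx_exp_step.
move: (st i) (st i.+1) (st i.+2) (st i.+3) (dec i) (dec i.+1) (dec i.+2); lia.
Qed.

(** * Commutators of square-zero matrices: closure properties and constructions *)

Definition sqz_commutator n (T : 'M[F]_n) := exists M N : 'M_n,
  [/\ M *m M = 0, N *m N = 0 & T = M *m N - N *m M].

Lemma hsimilar_sqz_commutator n m (X : 'M[F]_n) (Y : 'M[F]_m) :
  hsimilar X Y -> sqz_commutator X -> sqz_commutator Y.
Proof.
move=> [S [S' [SS' S'S ->]]] [M [N [MM NN ->]]].
have mulS A B : S *m A *m S' *m (S *m B *m S') = S *m (A *m B) *m S'.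
  by rewrite -!mulmxA (mulmxA S' S) S'S mul1mx.
exists (S *m M *m S'), (S *m N *m S').
by rewrite !mulS MM NN mulmx0 mul0mx mulmxBr mulmxBl.
Qed.

Lemma dsum_sqz_commutator n m (X : 'M[F]_n) (Y : 'M[F]_m) :
  sqz_commutator X -> sqz_commutator Y -> sqz_commutator (block_mx X 0 0 Y).
Proof.
move=> [M [N [MM NN ->]]] [M' [N' [MM' NN' ->]]].
exists (block_mx M 0 0 M'), (block_mx N 0 0 N').
rewrite !mulmx_block !mul0mx !mulmx0 !add0r !addr0 MM NN MM' NN' block_mx0.
by rewrite opp_block_mx add_block_mx !oppr0 !addr0.
Qed.

Lemma offdiag_sqz_commutator s s' (X : 'M[F]_(s, s')) (Y : 'M[F]_(s', s)) :
  sqz_commutator (block_mx (X *m Y) 0 0 (- (Y *m X))).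
Proof.
exists (block_mx 0 X 0 0), (block_mx 0 0 Y 0).
rewrite !mulmx_block !mul0mx !mulmx0 !add0r !addr0 !block_mx0.
by rewrite opp_block_mx add_block_mx !oppr0 !addr0 !add0r.
Qed.

Lemma shift_pair_sqz_commutator s s' : (s' <= s <= s'.+1)%N ->
  sqz_commutator (block_mx (shift_mx s s 1) 0 0 (shift_mx s' s' 1)).
Proof.
move=> /andP[s's ss'].
(* Conjugation by alternating signs negates the shift; this corrects the sign of the second
   off-diagonal product. *)
pose D : 'M[F]_s' := diag_mx (\row_i (-1) ^+ i).
have DD : D *m D = 1%:M.
  rewrite mulmx_diag; apply/matrixP=> i j; rewrite !mxE -expr2 sqrr_sign.
  by [].
have DJ : D *m shift_mx s' s' 1 *m D = - shift_mx s' s' 1.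
  apply/matrixP=> i j; rewrite mul_mx_diag mul_diag_mx !mxE.
  case: eqP => [<-|_]; last by rewrite mulr0 mul0r oppr0.
  by rewrite mulr1 addn1 exprS mulrCA -expr2 sqrr_sign mulr1.
have := offdiag_sqz_commutator (shift_mx s s' 0 *m D) (D *m shift_mx s' s 1).
rewrite !mulmxA -(mulmxA _ D D) DD mulmx1 -(mulmxA D (shift_mx s' s 1)).
(* The bounds s <= s'+1 and s' <= s are the side conditions of the two products. *)
by rewrite !mul_shift_mx ?addn0 ?addn1 // DJ opprK.
Qed.

Lemma sqr_nilpotent_sqz_commutator n (L : 'M[F]_n) :
  nilpotent_mx L -> sqz_commutator (L ^+ 2).
Proof.
move=> [p Lp]; apply: (@nilpotent_even_steps_ind sqz_commutator).
- exact: hsimilar_sqz_commutator.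
- exact: dsum_sqz_commutator.
- exact: shift_pair_sqz_commutator.
- by exists p; rewrite -exprM mulnC exprM Lp expr0n.
- exact: even_steps_sqr.
Qed.

Lemma nilpotent_even_steps_sqr n (T : 'M[F]_n) :
  nilpotent_mx T -> even_steps T -> exists2 L : 'M[F]_n, nilpotent_mx L & T = L ^+ 2.
Proof.
move=> nilT evT; suff [L TL] : exists L : 'M[F]_n, T = L ^+ 2.
  by exists L => //; case: nilT => p Tp; exists (2 * p)%N; rewrite exprM -TL.
apply: (@nilpotent_even_steps_ind (fun n T => exists L : 'M[F]_n, T = L ^+ 2)) nilT evT.
- move=> k m X Y [S [S' [SS' S'S ->]]] [L ->]; exists (S *m L *m S').
  by rewrite !expr2 -!mulmxE -!mulmxA (mulmxA S' S) S'S mul1mx.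
- by move=> k m X Y [L ->] [L' ->]; exists (block_mx L 0 0 L'); rewrite dsum_exp.
- move=> s s' /andP[s's ss'].
  exists (block_mx 0 (shift_mx s s' 0) (shift_mx s' s 1) 0).
  rewrite expr2 -mulmxE mulmx_block !mul0mx !mulmx0 !add0r !addr0.
  by rewrite !mul_shift_mx ?addn0 ?addn1.
Qed.

(** * Parity of the rank drops of a commutator *)

Lemma sqz_rank n (Z : 'M[F]_n) : Z *m Z = 0 -> (\rank Z + \rank Z <= n)%N.
Proof. by move=> ZZ; have := mxrank_mul_min Z Z; rewrite ZZ mxrank0; lia. Qed.

(** The homotopy gives n <= 2 rank Z and [sqz_rank] gives the converse, so n = 2 rank Z. *)
Lemma contractible_even n (Z W : 'M[F]_n) :
  Z *m Z = 0 -> Z *m W + W *m Z = 1%:M -> ~~ odd n.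
Proof.
move=> ZZ ZW; have := sqz_rank ZZ.
have : (n <= \rank Z + \rank Z)%N.
  rewrite -{1}(mxrank1 F n) -ZW; apply: leq_trans (mxrank_add _ _) _.
  by rewrite leq_add ?mxrankM_maxl ?mxrankM_maxr.
lia.
Qed.

(* [G] and [p] identify ker M0 / im M0 with [F^h]. *)
Lemma homology_basis n (M0 : 'M[F]_n) : M0 *m M0 = 0 ->
  exists (h : nat) (G : 'M_(h, n)) (p : 'M_(n, h)),
    [/\ n = (\rank M0 + \rank M0 + h)%N, G *m M0 = 0, M0 *m p = 0, G *m p = 1%:M
      & forall m (x : 'M_(m, n)), x *m M0 = 0 -> exists a, x = x *m p *m G + a *m M0].
Proof.
(* [D] is a complement of im M0 in ker M0; the rows of [G] will be a basis of it. *)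
move=> MM; pose D := (kermx M0 :\: M0)%MS.
have capD : (D :&: M0 = 0)%MS by apply: capmx_diff.
have subK : (M0 <= kermx M0)%MS by rewrite sub_kermx MM.
have capK : (kermx M0 :&: M0 :=: M0)%MS by apply/eqmxP; rewrite capmxSr sub_capmx subK /=.
have sumD : (D + M0 :=: kermx M0)%MS.
  apply: eqmx_trans (addsmx_diff_cap_eq (kermx M0) M0).
  by apply: adds_eqmx (eqmx_refl _) (eqmx_sym capK).
have [h [G [V [Gh GV GD subG]]]] : exists h (G : 'M_(h, n)) (V : 'M_(n, h)),
    [/\ h = \rank D, G *m V = 1%:M, (G <= D)%MS
      & forall m (x : 'M_(m, n)), (x <= D)%MS -> x *m V *m G = x].
  exists (\rank D), (row_base D), (pinvmx (row_base D)); split=> //.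
  - by rewrite mulmxVp ?row_base_free.
  - by rewrite eq_row_base.
  - by move=> m x xD; rewrite mulmxKpV // eq_row_base.
(* [p] projects onto [D] along im M0, then takes coordinates with respect to [G]. *)
exists h, G, (proj_mx D M0 *m V); split.
- have := mxrank_disjoint_sum capD; rewrite sumD mxrank_ker Gh.
  by have := rank_leq_row M0; lia.
- apply/eqP; rewrite -sub_kermx; apply: submx_trans GD _.
  by rewrite -sumD addsmxSl.
- by rewrite mulmxA proj_mx_0 ?mul0mx.
- by rewrite mulmxA proj_mx_id.
- move=> m x /eqP; rewrite -sub_kermx -sumD => xD.
  have /submxP[a ea] : (x *m proj_mx M0 D <= M0)%MS by apply: proj_mx_sub.
  exists a; rewrite -ea mulmxA subG ?proj_mx_sub //.
  by rewrite add_proj_mx.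
Qed.

(* On the homology of [M0], the hypothesis says that [M1] is a contracting
   homotopy for [N0]. *)
Lemma homotopy_even n (M0 N0 M1 N1 : 'M[F]_n) :
  M0 *m M0 = 0 -> N0 *m N0 = 0 -> M0 *m N0 = N0 *m M0 -> M0 *m M1 = M1 *m M0 ->
  M1 *m N0 + N0 *m M1 - (M0 *m N1 + N1 *m M0) = 1%:M -> ~~ odd n.
Proof.
move=> MM NN MN MM1 hom.
have [h [G [p [nh GM Mp Gp lift]]]] := homology_basis MM.
(* Maps commuting with [M0] induce maps on homology multiplicatively: the error [a *m M0] moves past
   [Y] and dies against [p]. *)
have red X Y : M0 *m X = X *m M0 -> M0 *m Y = Y *m M0 ->
    (G *m X *m p) *m (G *m Y *m p) = G *m (X *m Y) *m p.
  move=> MX MY.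
  have [|a ea] := lift _ (G *m X); first by rewrite -mulmxA -MX mulmxA GM mul0mx.
  rewrite [in RHS]mulmxA [in RHS]ea mulmxDl mulmxDl -(mulmxA a) MY -!mulmxA Mp.
  by rewrite !mulmx0 addr0 !mulmxA.
suff : ~~ odd h by lia.
apply: (@contractible_even h (G *m N0 *m p) (G *m M1 *m p)).
  by rewrite red // NN mulmx0 mul0mx.
rewrite !red // -mulmxDl -mulmxDr addrC.
(* The terms M0 N1 and N1 M0 vanish between [G] and [p], since G M0 = 0 and M0 p = 0. *)
rewrite -[M1 *m N0 + _](subrK (M0 *m N1 + N1 *m M0)) hom !mulmxDr !mulmxDl mulmx1 Gp.
by rewrite !mulmxA GM -!mulmxA Mp !mul0mx !mulmx0 !addr0.
Qed.

Lemma sqz_commutator_anticomm n (M N : 'M[F]_n) : M *m M = 0 -> N *m N = 0 ->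
  M *m (M *m N - N *m M) = - ((M *m N - N *m M) *m M) /\
  N *m (M *m N - N *m M) = - ((M *m N - N *m M) *m N).
Proof.
move=> MM NN; rewrite !mulmxBr !mulmxBl !mulmxA MM NN !mul0mx -!mulmxA MM NN !mulmx0.
by rewrite !sub0r !subr0 !opprK.
Qed.

Lemma anticomm_exp_sub n (X T : 'M[F]_n) j :
  X *m T = - (T *m X) -> (T ^+ j *m X <= T ^+ j)%MS.
Proof.
move=> XT; elim: j => [|j /submxP[D eD]]; first by rewrite expr0 submx1.
rewrite exprSr -mulmxE -mulmxA -[T *m X]opprK -XT mulmxN mulmxA eD -mulmxA.
by rewrite -mulNmx submxMl.
Qed.

Lemma sqz_commutator_even_steps n (T : 'M[F]_n) : sqz_commutator T -> even_steps T.
Proof.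
move=> [M [N [MM NN TMN]]] j.
have [MT NT] := sqz_commutator_anticomm MM NN; rewrite -TMN in MT NT.
have := rank_exp_step T j.+1; have := rank_exp_step T j.
have lesub : (T ^+ j.+1 :&: kermx T <= T ^+ j :&: kermx T)%MS.
  by rewrite capmxS // submx_exp_step.
have := mxrank_leqif_sup lesub.
set d := \rank (T ^+ j :&: kermx T) => -[_ led] rj rj1 eqd.
(* Equal drops give the nested spaces im T^(j+1) /\ ker T and im T^j /\ ker T the same dimension, so
   they coincide. *)
have {led eqd}dsub : (T ^+ j :&: kermx T <= T ^+ j.+1)%MS.
  have : \rank (T ^+ j.+1 :&: kermx T)%MS == d by lia.
  by rewrite led => /submx_trans; apply; apply: capmxSl.
have -> : (\rank (T ^+ j) - \rank (T ^+ j.+1))%N = d by lia.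
pose C := row_base (T ^+ j :&: kermx T)%MS.
have freeC : row_free C by apply: row_base_free.
have Csub m (x : 'M_(m, n)) : (x <= T ^+ j)%MS -> x *m T = 0 -> exists a, x = a *m C.
  move=> xj xT; suff /submxP[a ->] : (x <= C)%MS by exists a.
  by rewrite eq_row_base sub_capmx xj sub_kermx xT eqxx.
have Cj : (C <= T ^+ j)%MS by rewrite eq_row_base capmxSl.
have CT : C *m T = 0 by apply/eqP; rewrite -sub_kermx eq_row_base capmxSr.
(* [E] lifts [C] through [T]; the coordinates over [C] and [E] are the orders 0 and 1 of the
   expansion. *)
have [E Ej ET] : exists2 E : 'M_(d, n), (E <= T ^+ j)%MS & E *m T = C.
  have /submxP[D eD] : (C <= T ^+ j.+1)%MS by rewrite eq_row_base.
  by exists (D *m T ^+ j); rewrite ?submxMl // eD exprSr -mulmxE mulmxA.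
rewrite -/d in C freeC Csub Cj CT ET *.
clearbody C; move: d C freeC Csub Cj CT E Ej ET {dsub rj rj1 lesub}.
move=> d C freeC Csub Cj CT E Ej ET.
(* [X0] is the action on [C]. Anticommutation gives (EX + X0 E) T = -CX + X0 C = 0, whence the minus
   sign and the correction [X1]. *)
have Xdecomp X : X *m T = - (T *m X) -> exists X0 X1,
    C *m X = X0 *m C /\ E *m X = X1 *m C - X0 *m E.
  move=> XT; have subX m (x : 'M_(m, n)) : (x <= T ^+ j -> x *m X <= T ^+ j)%MS.
    by move=> xj; apply: submx_trans (submxMr X xj) (anticomm_exp_sub _ XT).
  have [||X0 eX0] := Csub _ (C *m X); first exact: subX.
    by rewrite -mulmxA XT mulmxN mulmxA CT mul0mx oppr0.
  have [||X1 eX1] := Csub _ (E *m X + X0 *m E).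
  - apply: addmx_sub; first exact: subX.
    by apply: submx_trans (submxMl _ _) Ej.
  - by rewrite mulmxDl -!mulmxA XT mulmxN ET -eX0 mulmxA ET addNr.
  by exists X0, X1; split=> //; rewrite -eX1 addrK.
have injC m (a b : 'M_(m, d)) : a *m C = b *m C -> a = b.
  by move=> ab; rewrite -(mulmxKp freeC a) ab mulmxKp.
have [M0 [M1 [CM EM]]] := Xdecomp M MT.
have [N0 [N1 [CN EN]]] := Xdecomp N NT.
(* A product rule twisted by the sign in [Xdecomp]. *)
have EXY X Y X0 X1 Y0 Y1 : C *m X = X0 *m C -> E *m X = X1 *m C - X0 *m E ->
    C *m Y = Y0 *m C -> E *m Y = Y1 *m C - Y0 *m E ->
    C *m (X *m Y) = X0 *m Y0 *m C /\
    E *m (X *m Y) = (X1 *m Y0 - X0 *m Y1) *m C + X0 *m Y0 *m E.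
  move=> CX EX CY EY; split; first by rewrite mulmxA CX -mulmxA CY mulmxA.
  rewrite mulmxA EX mulmxBl -!mulmxA CY EY mulmxBr opprB mulmxBl !mulmxA.
  by rewrite addrA addrAC.
have [CMM EMM] := EXY _ _ _ _ _ _ CM EM CM EM.
have [CNN _] := EXY _ _ _ _ _ _ CN EN CN EN.
have [CMN EMN] := EXY _ _ _ _ _ _ CM EM CN EN.
have [CNM ENM] := EXY _ _ _ _ _ _ CN EN CM EM.
have M00 : M0 *m M0 = 0 by apply: injC; rewrite -CMM MM mulmx0 mul0mx.
have N00 : N0 *m N0 = 0 by apply: injC; rewrite -CNN NN mulmx0 mul0mx.
have MN0 : M0 *m N0 = N0 *m M0.
  apply: injC; rewrite -CMN -CNM; apply/eqP.
  by rewrite -subr_eq0 -mulmxBr -TMN CT.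
apply: (@homotopy_even d M0 N0 M1 N1) => //.
  (* The first-order part of M^2 = 0 is M1 M0 - M0 M1 = 0. *)
  apply/esym/eqP; rewrite -subr_eq0; apply/eqP/injC.
  by move: EMM; rewrite MM mulmx0 M00 mul0mx addr0 mul0mx => <-.
(* The homotopy relation is the [C]-component of E (MN - NM) = ET = C. *)
apply: injC; rewrite mul1mx -[RHS]ET TMN mulmxBr EMN ENM MN0 [X in _ = _ - X]addrC.
rewrite addrKA -mulmxBl; congr (_ *m _).
by rewrite opprB opprD !addrA; congr (_ - _); rewrite addrAC.
Qed.

(** * The invertible part, and compatibility with the Fitting decomposition *)

Lemma unit_sqz_commutator n (T : 'M[F]_n) : T \in unitmx -> sqz_commutator T ->
  exists (k : nat) (A : 'M_k), A \in unitmx /\ hsimilar T (block_mx A 0 0 (- A)).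
Proof.
move=> uT [M [N [MM NN TMN]]].
have [r [B [rM freeB BM MB]]] : exists r (B : 'M_(r, n)),
    [/\ \rank M = r, row_free B, (B <= M)%MS & (M <= B)%MS].
  exists (\rank M), (row_base M); split=> //; first exact: row_base_free.
    by rewrite eq_row_base.
  by rewrite eq_row_base.
have BM0 : B *m M = 0.
  by have /submxP[D ->] := BM; rewrite -mulmxA MM mulmx0.
have BT : B *m T = - (B *m N *m M).
  by rewrite TMN mulmxBr !mulmxA BM0 mul0mx sub0r.
have /submxP[A eA] : (B *m T <= B)%MS.
  by rewrite BT -mulNmx; apply: submx_trans (submxMl _ _) MB.
have BNT : B *m N *m T = - A *m (B *m N).
  rewrite TMN mulmxBr !mulmxA -(mulmxA B N N) NN mulmx0 mul0mx subr0.
  by rewrite -[B *m N *m M]opprK -BT eA !mulNmx.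
pose S := col_mx B (B *m N).
have fullS : row_full S.
  (* The images of MN and NM lie in the span of BN and of B respectively, and [T] is invertible, so
     [S] spans everything. *)
  suff TS : (T <= S)%MS by rewrite -sub1mx (submx_trans _ TS) // sub1mx row_full_unit.
  have SE : (S :=: B + B *m N)%MS by apply: eqmx_sym; apply: addsmxE.
  rewrite TMN SE; apply: addmx_sub.
    by apply: submx_trans (addsmxSr _ _); apply: submxMr.
  rewrite -mulNmx; apply: submx_trans (submxMl _ _) _.
  exact: submx_trans MB (addsmxSl _ _).
(* [S] has 2 rank M rows, at most n by [sqz_rank], and rank n. *)
have freeS : row_free S.
  by rewrite -row_leq_rank (eqP fullS) -rM; apply: sqz_rank.
have simT : hsimilar T (block_mx A 0 0 (- A)).
  exists S, (pinvmx S); rewrite mulmxVp // mulVpmx //; split=> //.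
  have -> : S *m T = block_mx A 0 0 (- A) *m S.
    by rewrite mul_col_mx mul_block_col !mul0mx add0r addr0 eA BNT.
  by rewrite mulmxKp.
exists r, A; split=> //.
(* AB = BT has rank [r], because [B] is free and [T] invertible. *)
rewrite -row_free_unit -row_leq_rank; apply: (@leq_trans (\rank (A *m B))).
  by rewrite -eA mxrankMfree ?row_free_unit // row_leq_rank.
exact: mxrankM_maxl.
Qed.

(** Each off-diagonal block intertwines, up to sign, an invertible matrix with a nilpotent one;
    passing to [p]-th powers makes it vanish. *)
Lemma anticomm_fitting_dsum r m (T1 : 'M[F]_r) (T0 : 'M[F]_m) (X : 'M_(r + m)) :
  T1 \in unitmx -> nilpotent_mx T0 ->
  X *m block_mx T1 0 0 T0 = - (block_mx T1 0 0 T0 *m X) ->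
  exists X1 X0, X = block_mx X1 0 0 X0.
Proof.
move=> uT1 [p T0p]; rewrite -[X]submxK.
move: (ulsubmx X) (ursubmx X) (dlsubmx X) (drsubmx X) => X1 X2 X3 X0.
rewrite !mulmx_block !mul0mx !mulmx0 !add0r !addr0 opp_block_mx.
case/eq_block_mx => _; rewrite -!mulNmx => X2T X3T _.
exists X1, X0; suff -> : X2 = 0; first suff -> : X3 = 0 by [].
- have T1p : T1 ^+ p \in unitmx.
    by case: p {T0p} => [|p]; [apply: unitmx1 | rewrite unitmx_expE].
  rewrite -[X3](mulmxK T1p) (mulmx_exp_intertwine p X3T) exprNn T0p.
  by rewrite mulr0 !mul0mx.
- have T1p : (- T1) ^+ p \in unitmx.
    case: p {T0p} => [|p]; first exact: unitmx1.
    by rewrite unitmx_expE // -scaleN1r unitmxZ // unitrN1.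
  by rewrite -[X2](mulKmx T1p) -(mulmx_exp_intertwine p X2T) T0p !mulmx0.
Qed.

Lemma sqz_commutator_fitting_dsum r m (T1 : 'M[F]_r) (T0 : 'M[F]_m) :
  T1 \in unitmx -> nilpotent_mx T0 -> sqz_commutator (block_mx T1 0 0 T0) ->
  sqz_commutator T1 /\ sqz_commutator T0.
Proof.
move=> uT1 nilT0 [M [N [MM NN TMN]]].
have [MT NT] := sqz_commutator_anticomm MM NN; rewrite -TMN in MT NT.
have [M1 [M0 eM]] := anticomm_fitting_dsum uT1 nilT0 MT.
have [N1 [N0 eN]] := anticomm_fitting_dsum uT1 nilT0 NT.
move: MM NN TMN; rewrite eM eN !mulmx_block !mul0mx !mulmx0 !add0r !addr0.
rewrite opp_block_mx add_block_mx -!block_mx0.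
move=> /eq_block_mx[MM1 _ _ MM0] /eq_block_mx[NN1 _ _ NN0] /eq_block_mx[e1 _ _ e0].
by split; [exists M1, N1 | exists M0, N0].
Qed.

(** * Assembling the equivalence *)

Lemma similar_mx_castP n m (e : m = n) (X : 'M[F]_n) (Y : 'M[F]_m) :
  similar_mx X (castmx (e, e) Y) <-> hsimilar X Y.
Proof.
move: X; case: n / e => X; rewrite castmx_id; split.
  by move=> [S uS ->]; exists (invmx S), S; rewrite mulVmx ?mulmxV.
move=> [S [S' [SS' S'S ->]]].
have [uS' _] := mulmx1_unit S'S.
by exists S' => //; rewrite -[invmx S']mul1mx -SS' mulmxK.
Qed.

Lemma sqz_commutatorP n (T : 'M[F]_n) :
  sqz_commutator T <->
  exists (k m : nat) (A : 'M_k) (L : 'M_m),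
    [/\ A \in unitmx, nilpotent_mx L & hsimilar T (dsum_AmA_L2 A L)].
Proof.
split=> [cT|[k [m [A [L [uA nilL simT]]]]]].
  have [r [m [T1 [T0 [uT1 nilT0 simT]]]]] := fitting_split T.
  have [cT1 cT0] := sqz_commutator_fitting_dsum uT1 nilT0 (hsimilar_sqz_commutator simT cT).
  have [k [A [uA simT1]]] := unit_sqz_commutator uT1 cT1.
  have [L nilL T0L] := nilpotent_even_steps_sqr nilT0 (sqz_commutator_even_steps cT0).
  exists k, m, A, L; split=> //; apply: hsimilar_trans simT _.
  by rewrite T0L; apply: hsimilar_dsum simT1 (hsimilar_refl _).
apply: hsimilar_sqz_commutator (hsimilar_sym simT) _.
apply: dsum_sqz_commutator; last exact: sqr_nilpotent_sqz_commutator.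
(* Off-diagonal blocks A and 1 have the products A and A. *)
by have := offdiag_sqz_commutator A 1%:M; rewrite mulmx1 mul1mx.
Qed.

End Similarity.

Theorem theorem3p17 (R : realType) (n : nat) (hn : (2 <= n)%N) (T : 'M[R[i]]_n) :
  (exists M N : 'M[R[i]]_n, M ^+ 2 = 0 /\ N ^+ 2 = 0 /\ T = M *m N - N *m M)
  <->
  (exists (k m : nat) (Hkm : (k + k + m)%N = n) (A : 'M[R[i]]_k) (L : 'M[R[i]]_m),
     A \in unitmx /\ nilpotent_mx L /\
     similar_mx T (castmx (Hkm, Hkm) (dsum_AmA_L2 A L))).
Proof.
split=> [[M [N [MM [NN TMN]]]]|[k [m [e [A [L [uA [nilL simT]]]]]]]].
  have /sqz_commutatorP[k [m [A [L [uA nilL simT]]]]] : sqz_commutator T.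
    by exists M, N.
  (* The size equation is read off from the similarity; [m] is n - 2k. *)
  exists k, m, (esym (hsimilar_dim simT)), A, L.
  by do 2!split=> //; apply/similar_mx_castP.
have [M [N [MM NN ->]]] : sqz_commutator T.
  apply/sqz_commutatorP.
  by exists k, m, A, L; split=> //; move/similar_mx_castP: simT.
by exists M, N.
Qed.
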